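(* Let $\Delta$ be a $1$-dimensional flag simplicial complex on $[n]$, and let $p$ be an integer with $2\le p\le\nu(\overline\Delta)$. If $I_\Delta^{[p]}$ has a linear resolution, then $I_\Delta^{[q]}$ has a linear resolution for all integers $q$ with $p\le q\le\nu(\overline\Delta)$.
   Context: A $1$-dimensional flag simplicial complex $\Delta$ on $[n]=\{1,\dots,n\}$ is a $1$-dimensional simplicial complex whose Stanley--Reisner ideal $I_\Delta$ is generated in degree two; equivalently, a triangle-free graph on the vertex set $[n]$ (with at least one edge, isolated vertices allowed). $\overline{\Delta}$ denotes the complement graph on $[n]$, so $I_\Delta=(x_ix_j:\{i,j\}\in E(\overline\Delta))$ is the edge ideal of $\overline\Delta$ in $S=K[x_1,\dots,x_n]$, where $K$ is an arbitrary field. $\nu(\overline\Delta)$ is the largest size of a matching (set of pairwise disjoint edges) of $\overline\Delta$. The squarefree power $I_\Delta^{[q]}$ is generated by the squarefree monomials among the minimal generators of $I_\Delta^q$, i.e. by the products of the variables indexed by the $2q$ vertices of the $q$-matchings of $\overline\Delta$; it is generated in degree $2q$. An ideal $I$ generated in degree $t$ has a linear resolution if its graded Betti numbers (those of the minimal graded free $S$-resolution of $I$) satisfy $\beta_{i,j}(I)=0$ for all $i\ge0$ and all $j\ne i+t$. *)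

(* Defs.v *)
From mathcomp Require Import all_boot all_order all_algebra.
From mathcomp Require Export mpoly.

Set Implicit Arguments.
Unset Strict Implicit.
Unset Printing Implicit Defensive.

Import GRing.Theory.
Local Open Scope ring_scope.

Section Ideals.
Variables (K : fieldType) (n : nat).
Local Notation S := {mpoly K[n]}.

(* Ideals are Prop-valued subsets of S. *)
Definition ideal_gen (G : S -> Prop) (f : S) : Prop :=
  exists2 s : seq (S * S),
    (forall x, x \in s -> G x.2) & f = \sum_(x <- s) x.1 * x.2.

Definition ideal_pow (I : S -> Prop) (q : nat) : S -> Prop :=
  ideal_gen (fun f => exists2 t : q.-tuple S,
    (forall g, g \in t -> I g) & f = \prod_(g <- t) g).

Definition generated_in_degree (t : nat) (I : S -> Prop) : Prop :=
  forall f, I f <-> ideal_gen (fun g => I g /\ g \is t.-homog) f.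

(* For a monomial ideal these are the elements of its unique minimal set of
   monomial generators. *)
Definition min_mono_gen (I : S -> Prop) (m : 'X_{1..n}) : Prop :=
  I 'X_[m] /\ (forall m' : 'X_{1..n}, I 'X_[m'] -> (m' <= m)%MM -> m' = m).

Definition squarefree (m : 'X_{1..n}) : Prop := forall i, (m i <= 1)%N.

Definition sqfree_pow (I : S -> Prop) (q : nat) : S -> Prop :=
  ideal_gen (fun f => exists2 m : 'X_{1..n},
    min_mono_gen (ideal_pow I q) m /\ squarefree m & f = 'X_[m]).

(* The sequence  ... -> F_1 -> F_0 -> S,  F_i being the direct sum over
   k < rk i of S(- shift i k).  Elements of F_i are row vectors, and
   maps act by multiplication on the right. *)
Record free_seq := FreeSeq {
  rk : nat -> nat;
  shift : forall i, 'I_(rk i) -> nat;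
  diff : forall i, 'M[S]_(rk i.+1, rk i);
  aug : 'cV[S]_(rk 0)
}.

Definition graded (F : free_seq) : Prop :=
  (forall k, aug F k 0 \is (shift k).-homog) /\
  (forall i (a : 'I_(rk F i.+1)) (b : 'I_(rk F i)),
     diff F i a b = 0 \/
     exists2 d : nat, (d + shift b)%N = shift a & diff F i a b \is d.-homog).

Definition resolves (F : free_seq) (I : S -> Prop) : Prop :=
  [/\ forall f, I f <-> exists u : 'rV_(rk F 0), (u *m aug F) 0 0 = f,
      forall u : 'rV_(rk F 0),
        u *m aug F = 0 <-> exists v, u = v *m diff F 0
    & forall i (u : 'rV_(rk F i.+1)),
        u *m diff F i = 0 <-> exists v, u = v *m diff F i.+1].

(* The image of F_(i+1) lies in (x_1, ..., x_n) F_i. *)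
Definition minimal (F : free_seq) : Prop :=
  forall i a b, (diff F i a b)@_(0%MM) = 0.

Definition minimal_graded_free_resolution (F : free_seq) (I : S -> Prop) :=
  [/\ graded F, resolves F I & minimal F].

Definition betti (F : free_seq) (i j : nat) : nat :=
  #|[set k : 'I_(rk F i) | shift k == j]|.

(* Minimal graded free resolutions are unique up to graded isomorphism, so the
   numbers betti F i j do not depend on the choice of F. *)
Definition has_linear_resolution (I : S -> Prop) : Prop :=
  exists t : nat, generated_in_degree t I /\
    exists2 F : free_seq, minimal_graded_free_resolution F I &
      forall i j : nat, j <> (i + t)%N -> betti F i j = 0%N.

End Ideals.

Section Complexes.
Variable n : nat.
Implicit Type D : {set {set 'I_n}}.

Definition simplicial_complex D : Prop :=
  [/\ set0 \in D, forall i, [set i] \in D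
    & forall A B : {set 'I_n}, B \in D -> A \subset B -> A \in D].

(* The complex {set0} gets dimension 0 instead of -1, by truncation. *)
Definition dimension D : nat := (\max_(A in D) #|A|).-1.

Definition stanley_reisner (K : fieldType) D : {mpoly K[n]} -> Prop :=
  ideal_gen (fun f =>
    exists2 A : {set 'I_n}, A \notin D & f = \prod_(i in A) 'X_i).

Definition flag (K : fieldType) D : Prop :=
  generated_in_degree 2 (@stanley_reisner K D).

Definition complement_edges D : {set {set 'I_n}} :=
  [set e : {set 'I_n} | (#|e| == 2%N) && (e \notin D)].

Definition matching_number (E : {set {set 'I_n}}) : nat :=
  \max_(M : {set {set 'I_n}} | (M \subset E) && trivIset M) #|M|.

End Complexes.

Arguments stanley_reisner {n} K D _.
Arguments flag {n} K D.

(* Main.v *)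
(* Write x^V for the product of the variables indexed by V, and E for the edges
   of the complement graph.  The ideal I^[q] is generated by the x^V with V the
   vertex set of a q-matching in E.  As the graph D has no triangle, every
   3-set contains an edge of E, hence every (2q+1)-set contains a generator.
   So the simplicial complex of I^[q] has all sets of size < 2q and, as
   additional facets, the set B_q of the unmatched 2q-sets, and linearity of the
   resolution amounts to the vanishing of its top homology: no nonzero cycle is
   supported on B_q.  This is used in the dual form [cob_separates]: for each V
   in B_q there is a cochain whose coboundary restricts on B_q to the indicator
   of V.  If V is in B_(q+1) and e is an edge of E inside V, then V \ e is in B_q,
   and taking the wedge with the two endpoints of e turns a cochain for V \ e
   into one for V; this is the passage from q to q + 1.
   That linearity gives [cob_separates] follows by tensoring the resolution with
   the Koszul complex.  Conversely, the linear strand can be written down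
   explicitly, and [cob_separates] makes it exact. *)
Require Import Defs.
From mathcomp Require Import all_boot all_order all_algebra.
From mathcomp Require Import zify ring.

Set Implicit Arguments.
Unset Strict Implicit.
Unset Printing Implicit Defensive.

Import GRing.Theory.
Local Open Scope ring_scope.

(** * Coboundaries *)

Section Coboundary.
Variables (n : nat) (R : comNzRingType).
Implicit Types (v w : 'I_n) (U V W : {set 'I_n}) (g : {set 'I_n} -> R).

Definition sgn v U : R := (-1) ^+ #|[set u in U | (u < v)%N]|.

Lemma sgn_sqr v U : sgn v U * sgn v U = 1.
Proof. by rewrite -expr2 sqrr_sign. Qed.

Lemma sgnU1 v w U : w \notin U -> sgn v (w |: U) = (-1) ^+ (w < v)%N * sgn v U.
Proof.
move=> wU; rewrite /sgn; case: ltnP => [lt_wv|le_vw].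
  have -> : [set u in w |: U | (u < v)%N] = w |: [set u in U | (u < v)%N].
    by apply/setP=> u; rewrite !inE; case: eqP => [->|_] //=; rewrite lt_wv.
  by rewrite cardsU1 inE (negPf wU) /= exprD.
rewrite expr0 mul1r; congr (_ ^+ _); apply: eq_card => u; rewrite !inE.
by case: eqP => [->|//]; rewrite ltnNge le_vw (negPf wU).
Qed.

Lemma sgn_swap v w U : v != w -> v \notin U -> w \notin U ->
  sgn v (w |: U) * sgn w U = - (sgn w (v |: U) * sgn v U).
Proof.
move=> vw vU wU; rewrite !sgnU1 //.
case: (ltngtP v w) vw => [_ _|_ _|/val_inj->]; last by rewrite eqxx.
  by rewrite /= expr0 expr1; ring.
by rewrite /= expr0 expr1; ring.
Qed.

Lemma sgn_swap_inv v w U : v != w -> v \notin U -> w \notin U ->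
  sgn v (w |: U) * sgn w (v |: U) = - (sgn v U * sgn w U).
Proof.
move=> vw vU wU; rewrite !sgnU1 //.
case: (ltngtP v w) vw => [_ _|_ _|/val_inj->]; last by rewrite eqxx.
  by rewrite /= expr0 expr1; ring.
by rewrite /= expr0 expr1; ring.
Qed.

Definition cob g V : R := \sum_(v in V) sgn v (V :\ v) * g (V :\ v).

Lemma eq_cob g1 g2 V :
  (forall v, v \in V -> g1 (V :\ v) = g2 (V :\ v)) -> cob g1 V = cob g2 V.
Proof. by move=> eg; apply: eq_bigr => v vV; rewrite eg. Qed.

Lemma cobB g1 g2 V : cob (fun U => g1 U - g2 U) V = cob g1 V - cob g2 V.
Proof. by rewrite /cob -sumrB; apply: eq_bigr => v _; rewrite mulrBr. Qed.

Lemma cobZ c g V : cob (fun U => c * g U) V = c * cob g V.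
Proof. by rewrite /cob mulr_sumr; apply: eq_bigr => v _; rewrite mulrCA. Qed.

Lemma cob_sum (I : finType) (P : pred I) (G : I -> {set 'I_n} -> R) V :
  cob (fun U => \sum_(i | P i) G i U) V = \sum_(i | P i) cob (G i) V.
Proof.
rewrite /cob exchange_big /=; apply: eq_bigr => v _.
by rewrite mulr_sumr.
Qed.

(** The terms with [v < w] cancel those with [w < v]. The diagonal is assumed to vanish separately
    because [2] may be zero in [R]. *)
Lemma antisym_sum (a : 'I_n -> 'I_n -> R) :
  (forall v, a v v = 0) -> (forall v w, a v w = - a w v) ->
  \sum_v \sum_w a v w = 0.
Proof.
move=> a0 aN.
have split_v v : \sum_(w : 'I_n) a v w =
    \sum_(w : 'I_n | (w < v)%N) a v w + \sum_(w : 'I_n | (v < w)%N) a v w.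
  rewrite (bigID (fun w : 'I_n => (w < v)%N)) /=; congr (_ + _).
  rewrite (bigD1 v) ?ltnn //= a0 add0r; apply: eq_bigl => w.
  by rewrite -leqNgt ltn_neqAle andbC eq_sym.
rewrite (eq_bigr _ (fun v _ => split_v v)) big_split /=.
rewrite [X in _ + X](exchange_big_dep predT) //= -big_split /=.
apply: big1 => v _; rewrite -big_split /=; apply: big1 => w _.
by rewrite aN addNr.
Qed.

Lemma cob_cob g V : cob (cob g) V = 0.
Proof.
pose a v w := if (v \in V) && (w \in V) && (v != w) then
  sgn v (V :\ v) * sgn w (V :\ v :\ w) * g (V :\ v :\ w) else 0.
have -> : cob (cob g) V = \sum_v \sum_w a v w.
  rewrite /cob big_mkcond; apply: eq_bigr => v _.
  case: ifP => vV; last by rewrite big1 // => w _; rewrite /a vV.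
  rewrite mulr_sumr big_mkcond; apply: eq_bigr => w _.
  by rewrite /a !inE vV /= eq_sym andbC; case: ifP => _ //; rewrite mulrA.
apply: antisym_sum => [v|v w]; rewrite /a ?eqxx ?andbF // eq_sym.
rewrite [(w \in V) && _]andbC; case: ifP => [|_]; last by rewrite oppr0.
case/andP=> /andP[vV wV] wv.
have -> : V :\ w :\ v = V :\ v :\ w by apply/setP=> u; rewrite !inE andbCA.
rewrite -mulNr; congr (_ * _).
set U := V :\ v :\ w.
have -> : V :\ v = w |: U.
  by rewrite setD1K // !inE wv.
have -> : V :\ w = v |: U.
  by apply/setP=> u; rewrite !inE; case: (u =P v) => [->|]; rewrite ?vV ?(eq_sym v) ?wv ?orbT //=.
by apply: sgn_swap; rewrite /U ?inE ?eqxx ?(eq_sym v) //= ?andbF.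
Qed.

(** Exterior multiplication by the vertex [v]; it anticommutes with [cob]. *)
Definition wedge v g U : R :=
  if v \in U then sgn v (U :\ v) * g (U :\ v) else 0.

Lemma cob_wedge v g V : cob (wedge v g) V =
  if v \in V then - (sgn v (V :\ v) * cob g (V :\ v)) else 0.
Proof.
rewrite /cob; case: ifP => vV; last first.
  by apply: big1 => w _; rewrite /wedge !inE vV andbF mulr0.
rewrite (bigD1 v) //= {1}/wedge !inE eqxx mulr0 add0r mulr_sumr -sumrN.
apply: eq_big => w; first by rewrite !inE andbC.
case/andP=> wV wv; rewrite /wedge !inE eq_sym wv vV /=.
set U := V :\ w :\ v.
have -> : V :\ v :\ w = U by apply/setP=> u; rewrite !inE andbCA.
have -> : V :\ w = v |: U by rewrite setD1K // !inE eq_sym wv.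
have -> : V :\ v = w |: U.
  by rewrite /U; apply/setP=> u; rewrite !inE; case: (u =P w) => [->|]; rewrite ?wV ?wv //=.
rewrite !mulrA sgn_swap ?mulNr //; rewrite /U !inE ?eqxx ?andbF //.
Qed.

(** Interior product with [v], the homotopy that contracts the cochains of a full simplex having [v]
    as a vertex. *)
Definition contract v g U : R := if v \in U then 0 else sgn v U * g (v |: U).

(** Homotopy formula [cob (contract v g) + contract v (cob g) = g], evaluated at [U]: the second
    term involves [cob g] at [v |: U] only. *)
Lemma cob_contract v g U :
  (v \notin U -> cob g (v |: U) = 0) -> cob (contract v g) U = g U.
Proof.
case: (boolP (v \in U)) => [vU _|vU /(_ isT)].
  rewrite /cob (bigD1 v) //= big1 ?addr0 => [|w /andP[wU wv]].
    by rewrite /contract !inE eqxx /= setD1K // mulrA sgn_sqr mul1r.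
  by rewrite /contract !inE eq_sym wv vU mulr0.
rewrite /cob (bigD1 v) ?setU11 //= setU1K // => /eqP; rewrite addr_eq0 => /eqP E.
rewrite -[RHS]mul1r -(sgn_sqr v U) -mulrA E mulrN mulr_sumr -sumrN.
apply: eq_big => w.
  by rewrite !inE; case: (w =P v) => [->|]; rewrite ?(negPf vU) ?andbT.
move=> wU; have wv : w != v by apply: contraNneq vU => <-.
rewrite /contract !inE eq_sym wv (negPf vU) /=.
set X := U :\ w.
have eU : U = w |: X by rewrite setD1K.
have -> : (v |: U) :\ w = v |: X.
  by apply/setP=> u; rewrite !inE; case: (u =P v) => [->|]; rewrite ?(eq_sym v) ?wv.
have vX : v \notin X by rewrite !inE (negPf vU) andbF.
have wX : w \notin X by rewrite !inE eqxx.
rewrite {1}eU !mulrA sgn_swap_inv // 1?eq_sym // mulNr opprK.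
by rewrite [sgn w X * _]mulrC.
Qed.

End Coboundary.

(** * The Koszul complex *)

Section Koszul.
Variables (K : fieldType) (n : nat).
Local Notation S := {mpoly K[n]}.
Implicit Types (v w : 'I_n) (U V W : {set 'I_n}) (f : {set 'I_n} -> S).

(* The sign is that of [w] in [W], also on chains f W V over the sets W
   containing V: so [kos], acting on W, commutes with [cob], acting on V. *)
Definition kos f W : S := \sum_(w | w \notin W) sgn S w W * 'X_w * f (w |: W).

Lemma eq_kos f1 f2 W :
  (forall w, w \notin W -> f1 (w |: W) = f2 (w |: W)) -> kos f1 W = kos f2 W.
Proof. by move=> ef; apply: eq_bigr => w wW; rewrite ef. Qed.

Lemma kos0 W : kos (fun=> 0) W = 0.
Proof. by apply: big1 => w _; rewrite mulr0. Qed.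

Lemma kosB f1 f2 W : kos (fun U => f1 U - f2 U) W = kos f1 W - kos f2 W.
Proof. by rewrite /kos -sumrB; apply: eq_bigr => w _; rewrite mulrBr. Qed.

Lemma kosZ c f W : kos (fun U => c * f U) W = c * kos f W.
Proof. by rewrite /kos mulr_sumr; apply: eq_bigr => w _; rewrite mulrCA. Qed.

Lemma kos_sum (I : finType) (P : pred I) (F : I -> {set 'I_n} -> S) W :
  kos (fun U => \sum_(i | P i) F i U) W = \sum_(i | P i) kos (F i) W.
Proof.
by rewrite /kos exchange_big /=; apply: eq_bigr => w _; rewrite mulr_sumr.
Qed.

Lemma cob_kos (f : {set 'I_n} -> {set 'I_n} -> S) W V :
  cob (fun U => kos (fun X => f X U) W) V = kos (fun X => cob (f X) V) W.
Proof.
rewrite /cob /kos; under eq_bigr do rewrite mulr_sumr.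
rewrite exchange_big /=; apply: eq_bigr => w _; rewrite mulr_sumr.
by apply: eq_bigr => v _; rewrite mulrCA.
Qed.

Lemma kos_kos f W : kos (kos f) W = 0.
Proof.
pose a v w := if (v \notin W) && (w \notin W) && (v != w) then
  sgn S v W * 'X_v * (sgn S w (v |: W) * 'X_w * f (w |: (v |: W))) else 0.
have -> : kos (kos f) W = \sum_v \sum_w a v w.
  rewrite /kos big_mkcond; apply: eq_bigr => v _.
  case: ifP => vW; last by rewrite big1 // => w _; rewrite /a vW.
  rewrite mulr_sumr big_mkcond; apply: eq_bigr => w _.
  by rewrite /a !inE vW /= negb_or eq_sym andbC.
apply: antisym_sum => [v|v w]; rewrite /a ?eqxx ?andbF // eq_sym.
rewrite [(w \notin W) && _]andbC; case: ifP => [|_]; last by rewrite oppr0.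
case/andP=> /andP[vW wW] wv; rewrite [w |: _]setUCA.
transitivity (sgn S w (v |: W) * sgn S v W * ('X_v * 'X_w * f (v |: (w |: W)))).
  by ring.
by rewrite sgn_swap //; ring.
Qed.

Lemma sgn_mpolyC v U : sgn S v U = (sgn K v U)%:MP.
Proof. by rewrite /sgn rmorphXn /= rmorphN1. Qed.

Lemma mcoeffXM v (p : S) m :
  ('X_v * p)@_m = if m v == 0%N then 0 else p@_(m - U_(v))%MM.
Proof.
rewrite mulrC; case: ifP => [mv|/negbT mv]; last first.
  by rewrite -{1}(submK (m := U_(v)%MM) (m' := m)) ?lep1mP // addmC mcoeffMX.
apply/eqP; rewrite mcoeff_eq0; apply/negP.
rewrite (perm_mem (msuppMX _ _)) => /mapP[m' _ E].
by move: mv; rewrite E mnmDE mnm1E eqxx.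
Qed.

Lemma mcoeff_kos f W m : (kos f W)@_m =
  \sum_(w | w \notin W) sgn K w W *
     (if m w == 0%N then 0 else (f (w |: W))@_(m - U_(w))%MM).
Proof.
rewrite raddf_sum; apply: eq_bigr => w _ /=.
by rewrite -mulrA sgn_mpolyC mcoeffCM mcoeffXM.
Qed.

Lemma mpoly_of_coeffs (c : 'X_{1..n} -> K) b :
  (forall m, (b <= mdeg m)%N -> c m = 0) -> exists p : S, forall m, p@_m = c m.
Proof.
move=> c0; exists (\sum_(m : 'X_{1..n < b}) c m *: 'X_[m]) => m.
case: (ltnP (mdeg m) b) => [lt_mb|le_bm]; first exact: mcoeff_mpoly.
rewrite c0 // raddf_sum; apply: big1 => m' _ /=; rewrite mcoeffZ mcoeffX.
case: eqP => [E|]; last by rewrite mulr0.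
by move: (bmdeg m'); rewrite E ltnNge le_bm.
Qed.

(* The contracting homotopy divides by a variable, outside of [V], that is
   chosen as a function of the multidegree only. *)
Lemma kos_exact V k f :
    (forall W, V \subset W -> #|W|.+1 = k -> kos f W = 0) ->
    (forall m : 'X_{1..n}, #|V| = k -> (forall i, i \notin V -> m i = 0%N) ->
       (f V)@_m = 0) ->
  exists h, forall W, V \subset W -> #|W| = k -> f W = kos h W.
Proof.
(* An index outside [V] is eligible if it occurs in [m] or lies in [W], that is, in the total
   multidegree. Moving [w] from [m] to [W] therefore keeps the choice ([actE]). *)
move=> cyc f0; pose act (m : 'X_{1..n}) W :=
  [pick i | (i \notin V) && ((m i != 0%N) || (i \in W))].
pose hc W (m : 'X_{1..n}) : K := if act m W is Some a then
  if a \in W then sgn K a (W :\ a) * (f (W :\ a))@_(m + U_(a))%MM else 0 else 0.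
have /fin_all_exists[h hE] W : exists p : S, forall m, p@_m = hc W m.
  apply: (mpoly_of_coeffs (b := \max_U msize (f U))) => m le_bm.
  rewrite /hc; case: (act m W) => // a; case: ifP => // _.
  rewrite memN_msupp_eq0 ?mulr0 // msize_mdeg_ge // mdegD.
  apply: leq_trans (leq_addr _ _); apply: leq_trans le_bm.
  exact: (leq_bigmax (F := fun U => msize (f U))).
exists h => W sVW cW; apply/mpolyP=> m; rewrite mcoeff_kos.
have actE w : w \notin W -> m w != 0%N -> act (m - U_(w))%MM (w |: W) = act m W.
  move=> wW mw; apply: eq_pick => i /=; rewrite !inE mnmBE mnm1E.
  by have [->|iw] := eqVneq i w; rewrite ?mw ?orbT // subn0.
under eq_bigr => w wW.
  rewrite hE; rewrite (_ : (if _ then _ else _) = if m w == 0%N then 0 else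
    if act m W is Some a then
      if a \in w |: W then sgn K a ((w |: W) :\ a) *
        (f ((w |: W) :\ a))@_(m - U_(w) + U_(a))%MM else 0 else 0); last first.
    by case: ifP => // /negbT mw; rewrite /hc actE.
over.
rewrite {1}/act; case: pickP => [a /andP[aV aact]|none]; last first.
  (* Without an eligible index, [W = V] and [m] is supported in [V]: the only place where homology
     can occur, excluded by [f0]. *)
  rewrite big1 => [|w _]; last by case: ifP; rewrite mulr0.
  have eWV : W = V.
    apply/eqP; rewrite eqEsubset sVW andbT; apply/subsetP=> i iW.
    by apply/negPn/negP=> iV; move: (none i); rewrite iV iW orbT.
  rewrite eWV f0 // -?eWV // => i; rewrite eWV => iV.
  by move: (none i); rewrite iV /=; case: eqP.
(* If [a] is not in [W], only the term [w = a] survives. If it is, the cycle condition at [W :\ a]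
   in degree [m + U_(a)] gives the coefficient of [f W] in terms of the others. *)
case: (boolP (a \in W)) aact => [aW _|aW]; last first.
  rewrite orbF => ma; rewrite (bigD1 a) //= (negPf ma) setU11 setU1K //.
  rewrite submK ?lep1mP // mulrA sgn_sqr mul1r big1 ?addr0 // => w /andP[wW wa].
  by rewrite !inE [a == w]eq_sym (negPf wa) (negPf aW); case: ifP; rewrite mulr0.
pose U := W :\ a.
have aU : a \notin U by rewrite !inE eqxx.
have WE : a |: U = W by rewrite setD1K.
have sVU : V \subset U.
  by apply/subsetP=> i iV; rewrite !inE (subsetP sVW) // andbT; apply: contraNneq aV => <-.
have cU : #|U|.+1 = k by rewrite -cW (cardsD1 a W) aW.
have := congr1 (mcoeff (m + U_(a))%MM) (cyc U sVU cU).
rewrite mcoeff_kos mcoeff0 (bigD1 a) //= WE.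
rewrite mnmDE mnm1E eqxx addn1 /= addmK => /eqP; rewrite addr_eq0 => /eqP E.
rewrite -[LHS]mul1r -(sgn_sqr K a U) -mulrA E mulrN mulr_sumr -sumrN.
apply: eq_big => w; first by rewrite !inE negb_and negbK; case: (w =P a) => [->|]; rewrite ?aW ?andbT.
case/andP=> wU wa; rewrite mnmDE mnm1E [a == w]eq_sym (negPf wa) addn0.
case: ifP => [_|/negbT mw]; first by rewrite !mulr0 oppr0.
have -> : (a \in w |: W) = true by rewrite !inE aW orbT.
have -> : (w |: W) :\ a = w |: U.
  by apply/setP=> i; rewrite !inE; case: (i =P w) => [->|]; rewrite ?wa.
have -> : (m + U_(a) - U_(w))%MM = (m - U_(w) + U_(a))%MM.
  apply/mnmP=> i; rewrite !(mnmDE, mnmBE, mnm1E).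
  by case: (w =P i) => [<-|_]; rewrite ?subn0 // eq_sym (negPf wa) !addn0.
rewrite -WE !mulrA -mulNr; congr (_ * _).
by rewrite sgn_swap_inv // [_ * sgn K a U]mulrC.
Qed.

End Koszul.

(** * The double complex of cochains and Koszul chains *)

Section Cocycles.
Variables (K : fieldType) (n : nat).
Local Notation S := {mpoly K[n]}.
Implicit Types (v w : 'I_n) (U V W X : {set 'I_n}).
Implicit Types (f g h : {set 'I_n} -> {set 'I_n} -> S).

Lemma mesym1U1 w V : w \notin V -> mesym1 (w |: V) = (U_(w) + mesym1 V)%MM.
Proof.
move=> wV; apply/mnmP=> i; rewrite !mnmE !inE eq_sym.
by case: eqP => [<-|//]; rewrite (negPf wV).
Qed.

(** Both sides run over the pairs of a set [V] of size [d] and a point [w] outside [V], with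
    [W = w |: V]. The augmentation is thus compatible with both differentials. *)
Lemma sum_kos_cob g d :
  \sum_(V : {set 'I_n} | #|V| == d) 'X_[mesym1 V] * kos (g^~ V) V =
  \sum_(W : {set 'I_n} | #|W| == d.+1) 'X_[mesym1 W] * cob (g W) W.
Proof.
rewrite /kos /cob; under eq_bigr do rewrite mulr_sumr.
under [RHS]eq_bigr do rewrite mulr_sumr.
rewrite (exchange_big_dep predT) //= [RHS](exchange_big_dep predT) //=.
apply: eq_bigr => w _.
rewrite [RHS](reindex_onto (fun V => w |: V) (fun W => W :\ w)) /=; last first.
  by move=> W /andP[_ wW]; rewrite setD1K.
apply: eq_big => V.
  rewrite setU11 andbT; case: (boolP (w \in V)) => wV; rewrite ?andbF ?andbT.
    apply/esym/negbTE/negP=> /andP[_ /eqP E].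
    by move: wV; rewrite -E !inE eqxx.
  by rewrite cardsU1 wV setU1K ?eqxx // andbT eqSS.
case/andP=> _ wV; rewrite setU1K // mesym1U1 // mpolyXD; ring.
Qed.

(* Zigzag in the double complex with differentials [cob] and [kos]: both are
   exact in the relevant range, so closedness descends from [d] to [d - 1]. *)
Lemma cocycle_exact d k f :
    (d <= k)%N ->
    (forall W U, #|W| = k -> U \subset W -> #|U| = d.+1 -> cob (f W) U = 0) ->
    (forall W V, #|W|.+1 = k -> V \subset W -> #|V| = d -> kos (f^~ V) W = 0) ->
    (k = d -> \sum_(V : {set 'I_n} | #|V| == d) 'X_[mesym1 V] * f V V = 0) ->
  exists h,
    (forall W U, #|W| = k.+1 -> U \subset W -> #|U| = d.+1 ->
       cob (h W) U = 0) /\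
    (forall W V, #|W| = k -> V \subset W -> #|V| = d -> f W V = kos (h^~ V) W).
Proof.
elim: d k f => [|d IH] k f le_dk fcob fkos faug.
  (* For [d = 0] the entry [f W set0] is zero: by the coboundary at a point of [W], or by [faug] if
     [W] is empty. *)
  exists (fun _ _ => 0); split=> [W U _ _ _|W V cW sVW /cards0_eq->].
    by apply: big1 => v _; rewrite mulr0.
  rewrite kos0; case: k => [|k] in cW faug fcob fkos le_dk *.
    have /eqP := faug erefl; rewrite (big_pred1 set0) => [|V']; last first.
      by rewrite cards_eq0.
    rewrite (cards0_eq cW) mulf_eq0 => /orP[/eqP /(congr1 (mcoeff (mesym1 set0)))|/eqP //].
    by rewrite mcoeffX eqxx mcoeff0 => /eqP; rewrite oner_eq0.
  have /set0Pn[w wW] : W != set0 by rewrite -card_gt0 cW.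
  have := fcob W [set w] cW; rewrite sub1set cards1 => /(_ wW erefl) /eqP.
  by rewrite /cob big_set1 setDv mulf_eq0 /sgn signr_eq0 => /eqP.
case: k => // k in le_dk fcob fkos faug *.
(* On the full simplex [W] the cocycle [f W] is the coboundary of its contraction with any point of
   [W]. *)
pose g W V := if [pick w in W] is Some w then contract w (f W) V else 0.
have gE W U : #|W| = k.+1 -> U \subset W -> #|U| = d.+1 -> cob (g W) U = f W U.
  move=> cW sUW cU; rewrite /g; case: pickP => [w wW|W0]; last first.
    have /set0Pn[w] : W != set0 by rewrite -card_gt0 cW.
    by rewrite W0.
  apply: cob_contract => wU; apply: fcob => //; last by rewrite cardsU1 wU cU.
  by rewrite subUset sub1set wW.
(* The Koszul boundary of [g] is closed for [cob], since its coboundary is that of [f] under [kos],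
   which is zero; so the induction hypothesis applies to it. *)
have [h1 [h1cob h1kos]] : exists h1,
    (forall W U, #|W| = k.+1 -> U \subset W -> #|U| = d.+1 ->
       cob (h1 W) U = 0) /\
    (forall W V, #|W| = k -> V \subset W -> #|V| = d ->
       kos (g^~ V) W = kos (h1^~ V) W).
  apply: (IH k (fun X V => kos (g^~ V) X)) => // [X U cX sUX cU|X V cX _ _|ek].
  - rewrite (cob_kos g) -[RHS](fkos X U) ?cX //; apply: eq_kos => w wX.
    rewrite gE ?cardsU1 ?wX ?cX //.
    exact: subset_trans sUX (subsetUr _ _).
  - exact: kos_kos.
  rewrite ek in gE fcob fkos faug *.
  rewrite sum_kos_cob -[RHS]faug //; apply: eq_bigr => W /eqP cW.
  by rewrite gE.
(* Now [g - h1] is a Koszul cycle, hence [kos e], and [f = cob (g - h1) = kos (cob e)]. The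
   exceptional case [W = V] is ruled out by size. *)
have /fin_all_exists[e eE] V : exists e : {set 'I_n} -> S, #|V| = d ->
    forall W, V \subset W -> #|W| = k.+1 -> g W V - h1 W V = kos e W.
  case: (eqVneq #|V| d) => [cV|/eqP cV]; last by exists (fun=> 0).
  have [|m ek|e He] := @kos_exact _ _ V k.+1 (fun W => g W V - h1 W V).
  - move=> W sVW [cW]; rewrite kosB h1kos ?subrr //.
  - by move: le_dk; rewrite -cV ek ltnn.
  by exists e.
exists (fun W => cob (fun V => e V W)); split=> [W U _ _ _|W V cW sVW cV].
  exact: cob_cob.
rewrite -(cob_kos (fun X V => e V X)) -[LHS]subr0 -(h1cob W V) // -gE // -cobB.
apply: eq_cob => v vV; apply: eE => //.
  by move: cV; rewrite (cardsD1 v) vV => -[].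
exact: subset_trans (subD1set _ _) sVW.
Qed.

(* Dual to: no nonzero cycle is supported on [B]. *)
Definition cob_separates (B : {set {set 'I_n}}) := forall V, V \in B ->
  exists y : {set 'I_n} -> K, forall V', V' \in B -> cob y V' = (V' == V)%:R.

Lemma cob_mpolyC (y : {set 'I_n} -> K) V :
  cob (fun U => (y U)%:MP : S) V = (cob y V)%:MP.
Proof.
rewrite /cob rmorph_sum; apply: eq_bigr => v _.
by rewrite rmorphM /= -sgn_mpolyC.
Qed.

(** The [h] of [cocycle_exact] need not vanish on [B], but there it is a Koszul boundary [kos e].
    Separation provides a coboundary [c] that agrees with [e] on [B]; subtracting [kos c] from [h]
    disturbs neither differential. *)
Lemma cocycle_exact_on (B : {set {set 'I_n}}) d k f :
    (forall V, V \in B -> #|V| = d) -> cob_separates B ->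
    (d <= k)%N ->
    (forall W U, #|W| = k -> U \subset W -> #|U| = d.+1 -> cob (f W) U = 0) ->
    (forall W V, #|W|.+1 = k -> V \subset W -> #|V| = d -> kos (f^~ V) W = 0) ->
    (k = d -> \sum_(V : {set 'I_n} | #|V| == d) 'X_[mesym1 V] * f V V = 0) ->
    (forall W V, #|W| = k -> V \subset W -> V \in B -> f W V = 0) ->
  exists h,
    [/\ forall W U, #|W| = k.+1 -> U \subset W -> #|U| = d.+1 ->
          cob (h W) U = 0,
        forall W V, #|W| = k -> V \subset W -> #|V| = d ->
          f W V = kos (h^~ V) W
      & forall W V, #|W| = k.+1 -> V \subset W -> V \in B -> h W V = 0].
Proof.
move=> cB sepB le_dk fcob fkos faug fB.
have [h [hcob hkos]] := cocycle_exact le_dk fcob fkos faug.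
have /fin_all_exists[e eE] V : exists e : {set 'I_n} -> S, V \in B ->
    forall W, V \subset W -> #|W| = k.+1 -> h W V = kos e W.
  case: (boolP (V \in B)) => [VB|/negP VB]; last by exists (fun=> 0).
  have [|m ek|e He] := @kos_exact _ _ V k.+1 (h^~ V).
  - move=> W sVW [cW]; rewrite -(hkos W V cW sVW) ?fB //; exact: cB.
  - by move: le_dk; rewrite -(cB V VB) ek ltnn.
  by exists e.
have /fin_all_exists[y yE] V : exists y : {set 'I_n} -> K, V \in B ->
    forall V', V' \in B -> cob y V' = (V' == V)%:R.
  by case: (boolP (V \in B)) => [/sepB[y yE]|/negP VB]; [exists y | exists (fun=> 0)].
pose c W := cob (fun U => \sum_(V in B) e V W * (y V U)%:MP).
have cE W V : V \in B -> c W V = e V W.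
  move=> VB; rewrite /c cob_sum (bigD1 V) //= cobZ cob_mpolyC yE // eqxx mulr1.
  rewrite big1 ?addr0 // => V' /andP[V'B V'V].
  by rewrite cobZ cob_mpolyC yE // eq_sym (negPf V'V) mulr0.
exists (fun W V => h W V - kos (c^~ V) W); split=> W V cW sVW cV.
- rewrite cobB (cob_kos c) hcob // sub0r.
  rewrite (@eq_kos _ _ _ (fun=> 0)) ?kos0 ?oppr0 // => w _; exact: cob_cob.
- by rewrite kosB kos_kos subr0 hkos.
rewrite (eE V) // -kosB -[RHS](kos0 K W); apply: eq_kos => w _.
by rewrite cE // subrr.
Qed.

End Cocycles.

(** * Tensoring a resolution with the Koszul complex *)

Section Zigzag.
Variables (K : fieldType) (n : nat).
Local Notation S := {mpoly K[n]}.
Implicit Types (v w : 'I_n) (U V W X : {set 'I_n}).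

Lemma mcoeffM_homog (p q : S) e m :
  q \is e.-homog -> mdeg m = e -> (p * q)@_m = p@_0%MM * q@_m.
Proof.
move=> hq dm; rewrite -[RHS]mcoeffCM !mcoeffM; apply: eq_bigr => k /eqP mE.
case: (eqVneq (mdeg k.2) e) => [dk|/(dhomog_nemf_coeff hq)->]; last by rewrite !mulr0.
suff -> : bmnm k.1 = 0%MM by rewrite mcoeffC eqxx mulr1.
by apply/eqP; rewrite -mdeg_eq0 -(eqn_add2r e) -{1}dk -mdegD -mE; apply/eqP.
Qed.

Definition vanishes_below e (p : S) := forall m, (mdeg m < e)%N -> p@_m = 0.

Lemma vanishes_below_kos e (f : {set 'I_n} -> S) W :
  (forall w, w \notin W -> vanishes_below e (f (w |: W))) ->
  vanishes_below e.+1 (kos f W).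
Proof.
move=> f0 m dm; rewrite mcoeff_kos big1 // => w wW; case: ifP => [_|/negbT mw].
  by rewrite mulr0.
rewrite f0 ?mulr0 // -ltnS; apply: leq_trans dm; rewrite ltnS.
by rewrite -{2}(submK (m := U_(w)%MM) (m' := m)) ?lep1mP // mdegD mdeg1 addn1.
Qed.

Definition const_part r (u : 'rV[S]_r) : 'rV[S]_r :=
  map_mx (fun p : S => (p@_0%MM)%:MP) u.

(** Only the constant terms of [u] contribute to the degree [e] part of [u *m A], and this part is
    zero by assumption. *)
Lemma const_part_mulmx r s (u : 'rV[S]_r) (A : 'M[S]_(r, s)) e :
    (forall a b, A a b \is e.-homog) ->
    (forall b, vanishes_below e.+1 ((u *m A) 0 b)) ->
  const_part u *m A = 0.
Proof.
move=> hA uA; apply/rowP=> b; rewrite mxE [RHS]mxE; apply/mpolyP=> m.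
rewrite mcoeff0 raddf_sum /=.
case: (eqVneq (mdeg m) e) => [dm|dm]; last first.
  rewrite big1 // => a _; rewrite mxE mcoeffCM (dhomog_nemf_coeff (hA a b) dm).
  by rewrite mulr0.
have := uA b m; rewrite dm ltnS leqnn => /(_ isT) uAm.
rewrite -[RHS]uAm mxE raddf_sum; apply: eq_bigr => a _ /=.
by rewrite mxE mcoeffCM (mcoeffM_homog _ (hA a b)).
Qed.

Definition kosv r (u : {set 'I_n} -> 'rV[S]_r) W : 'rV[S]_r :=
  \row_b kos (fun X => u X 0 b) W.

Lemma kosv_mulmx r s (u : {set 'I_n} -> 'rV[S]_r) (A : 'M[S]_(r, s)) W :
  kosv (fun X => u X *m A) W = kosv u W *m A.
Proof.
apply/rowP=> b; rewrite !mxE.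
under [RHS]eq_bigr => a _ do rewrite mxE mulrC -kosZ.
rewrite -kos_sum; apply: eq_kos => w _; rewrite mxE.
by apply: eq_bigr => a _; rewrite mulrC.
Qed.

Lemma kosvB r (u1 u2 : {set 'I_n} -> 'rV[S]_r) W :
  kosv (fun X => u1 X - u2 X) W = kosv u1 W - kosv u2 W.
Proof. by apply/rowP=> b; rewrite !mxE -kosB; apply: eq_kos => w _; rewrite !mxE. Qed.

Lemma kosv_kosv r (u : {set 'I_n} -> 'rV[S]_r) W : kosv (kosv u) W = 0.
Proof.
apply/rowP=> b; rewrite !mxE -[RHS](kos_kos (fun X => u X 0 b) W).
by apply: eq_kos => w _; rewrite mxE.
Qed.

Lemma eq_kosv r (u1 u2 : {set 'I_n} -> 'rV[S]_r) W :
  (forall w, w \notin W -> u1 (w |: W) = u2 (w |: W)) -> kosv u1 W = kosv u2 W.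
Proof. by move=> eu; apply/rowP=> b; rewrite !mxE; apply: eq_kos => w /eu->. Qed.

Lemma kosv_exact r k (u : {set 'I_n} -> 'rV[S]_r) :
    (forall W, #|W|.+1 = k -> kosv u W = 0) ->
    (k = 0%N -> forall b, (u set0 0 b)@_0%MM = 0) ->
  exists h, forall W, #|W| = k -> u W = kosv h W.
Proof.
move=> cyc u0.
have /fin_all_exists[h hE] b : exists h : {set 'I_n} -> S,
    forall W, #|W| = k -> u W 0 b = kos h W.
  have [W _ cW|m|h hE] := @kos_exact K n set0 k (fun X => u X 0 b).
  - by have /rowP/(_ b) := cyc W cW; rewrite !mxE.
  - rewrite cards0 => /esym k0 m0; suff -> : m = 0%MM by apply: u0.
    by apply/mnmP=> i; rewrite m0 ?inE // mnm0E.
  by exists h => W; apply: hE; exact: sub0set.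
exists (fun W => \row_b h b W) => W cW; apply/rowP=> b; rewrite !mxE hE //.
by apply: eq_kos => w _; rewrite mxE.
Qed.

(* Comparison of the two ways of computing Tor: the complex of the [A j] is
   tensored with the Koszul complex.  A lift of an element without constant
   term can be chosen without constant term because [A j] is homogeneous. *)
Lemma kosv_zigzag (r e : nat -> nat) (A : forall j, 'M[S]_(r j.+1, r j)) :
    (forall j a b, A j a b \is (e j).-homog) ->
    (forall j, e j.+1 = 1%N) ->
    (forall j (u : 'rV_(r j.+1)), u *m A j = 0 <-> exists x, u = x *m A j.+1) ->
  forall k j (u : {set 'I_n} -> 'rV[S]_(r j)),
    (forall W b, #|W| = k -> vanishes_below (e j) (u W 0 b)) ->
    (forall W b, #|W| = k -> (u W 0 b)@_0%MM = 0) ->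
    (forall W, #|W|.+1 = k -> exists x, kosv u W = x *m A j) ->
  exists h h', forall W, #|W| = k -> u W = kosv h W + h' W *m A j.
Proof.
move=> hA e1 exA; elim=> [|k IH] j u u_ord u_const u_im.
  have [//|_ b|h hE] := @kosv_exact _ 0 u; first exact: u_const (cards0 _).
  by exists h, (fun=> 0) => W cW; rewrite mul0mx addr0 hE.
have /fin_all_exists[u' u'E] W : exists x, #|W| = k ->
    kosv u W = x *m A j /\ forall b, (x 0 b)@_0%MM = 0.
  case: (eqVneq #|W| k) => [cW|/eqP cW]; last by exists 0.
  have [|x xE] := u_im W; first by rewrite cW.
  exists (x - const_part x) => _; split; last first.
    by move=> b; rewrite !mxE mcoeffB mcoeffC eqxx mulr1 subrr.
  rewrite mulmxBl (const_part_mulmx (hA j)) ?subr0 // => b.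
  rewrite -xE mxE; apply: vanishes_below_kos => w wW.
  by apply: u_ord; rewrite cardsU1 wW cW.
have [||W cW|h [h' hE]] := IH j.+1 u'.
- move=> W b cW m; rewrite e1 ltnS leqn0 mdeg_eq0 => /eqP->.
  by have [_ ->] := u'E W cW.
- by move=> W b cW; have [_ ->] := u'E W cW.
- apply/exA; rewrite -kosv_mulmx -[RHS](kosv_kosv u W); apply: eq_kosv => w wW.
  by have [|-> //] := u'E (w |: W); rewrite cardsU1 wW.
(* The difference is a Koszul cycle because consecutive maps [A j.+1] and [A j] compose to zero. *)
have [|//|g gE] := @kosv_exact _ k.+1 (fun W => u W - h W *m A j).
  move=> W [cW]; rewrite kosvB kosv_mulmx; have [-> _] := u'E W cW.
  rewrite hE // mulmxDl (_ : h' W *m _ *m _ = 0) ?addr0 ?subrr //.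
  by apply/exA; exists (h' W).
by exists g, h => W cW; rewrite -gE // subrK.
Qed.

End Zigzag.

(** * From a linear resolution to separation *)

Section Necessity.
Variables (K : fieldType) (n : nat).
Local Notation S := {mpoly K[n]}.
Implicit Types (v w : 'I_n) (U V W X : {set 'I_n}) (M : {set {set 'I_n}}).

(** Membership is tested on supports; [mesym1 V] is the exponent vector of x^V. *)
Definition monomial_ideal (J : S -> Prop) M := forall f, J f <->
  forall m, m \in msupp f -> exists2 V, V \in M & (mesym1 V <= m)%MM.

Lemma mesym1_le U V : (mesym1 U <= mesym1 V)%MM = (U \subset V).
Proof.
apply/mnm_lepP/subsetP => [le i iU|sUV i]; last first.
  by rewrite !mnmE; case: (boolP (i \in U)) => // /sUV->.
by have := le i; rewrite !mnmE iU; case: (i \in V).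
Qed.

Lemma mesym1D1 w V : w \in V -> (mesym1 V - U_(w))%MM = mesym1 (V :\ w).
Proof. by move=> wV; rewrite -{1}(setD1K wV) mesym1U1 ?setD11 // addmC addmK. Qed.

(** Exactly [w] indices lie below [w], and each is in one of [~: V] and [V :\ w]. *)
Lemma sgnC w V : w \in V -> sgn K w (~: V) * sgn K w (V :\ w) = (-1) ^+ w.
Proof.
move=> wV; rewrite /sgn -exprD; congr (_ ^+ _).
pose C := [set u : 'I_n | (u < w)%N].
have cC : #|C| = w.
  rewrite -sum1_card (eq_bigl (fun u : 'I_n => (u < w)%N)) => [|u]; last by rewrite inE.
  by rewrite -(big_ord_widen _ (fun=> 1%N)) ?sum1_card ?card_ord // ltnW.
rewrite -[RHS]cC -(cardsID V C) addnC; congr (_ + _)%N; apply: eq_card => u.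
  by rewrite !inE; case: (u =P w) => [->|_]; rewrite ?ltnn ?andbF //= andbC.
by rewrite !inE.
Qed.

(* Twisting by [parity] turns the signs relative to the complement of V, which
   come from the Koszul complex, into signs relative to V. *)
Definition parity V : K := (-1) ^+ (\sum_(j in V) j)%N.

Lemma parityD1 w V : w \in V -> parity V = (-1) ^+ w * parity (V :\ w).
Proof. by move=> wV; rewrite /parity (big_setD1 w) //= exprD. Qed.

Lemma parity_sqr V : parity V * parity V = 1.
Proof. by rewrite -expr2 sqrr_sign. Qed.

Lemma mcoeffM_lt (p q : S) e m :
  q \is e.-homog -> (mdeg m < e)%N -> (p * q)@_m = 0.
Proof.
move=> hq dm; rewrite mcoeffM big1 // => k /eqP mE.
rewrite (dhomog_nemf_coeff hq) ?mulr0 //; apply: contraTneq dm => dk.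
by rewrite -leqNgt (congr1 mdeg mE) mdegD dk leq_addl.
Qed.

(* The ring itself is put in position 0, before the resolution. *)
Definition chain_rank (F : free_seq K n) j := if j is i.+1 then rk F i else 1%N.

Definition chain_map (F : free_seq K n) j :
    'M[S]_(chain_rank F j.+1, chain_rank F j) :=
  match j with 0 => aug F | i.+1 => diff F i end.


(** For [V] of size [d] outside [M], the chain with value x^V at [~: V] is a Koszul cycle modulo J.
    Linearity forces its class in Tor to vanish for degree reasons, so it is a Koszul boundary plus
    a chain with values in J. The coefficients of x^V' then give the cochain. *)
Lemma linear_separates (J : S -> Prop) M d :
    monomial_ideal J M -> (forall V, V \in M -> #|V| = d) ->
    (0 < d)%N -> M != set0 ->
    (forall U, #|U| = d.+1 -> exists2 V, V \in M & V \subset U) ->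
    has_linear_resolution J ->
  cob_separates K [set V : {set 'I_n} | (#|V| == d) && (V \notin M)].
Proof.
move=> JM cM d_gt0 /set0Pn[V0 V0M] M1 [t [gen [F [[gr_aug gr_diff] [res1 res2 res3] _] lin]]].
have shiftE i (a : 'I_(rk F i)) : shift a = (i + t)%N.
  case: (eqVneq (shift a) (i + t)%N) => [//|/eqP/lin/eqP].
  by rewrite cards_eq0 => /eqP/setP/(_ a); rewrite !inE eqxx.
(* The definition of linearity leaves [t] open. This bound ensures that x^V vanishes below degree
   [t], as the zigzag requires. *)
have le_td : (t <= d)%N.
  rewrite leqNgt; apply/negP=> lt_dt.
  have /gen[s sgen E] : J 'X_[mesym1 V0].
    by apply/JM=> m; rewrite msuppX inE => /eqP->; exists V0; rewrite ?lepm_refl.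
  have /eqP := congr1 (mcoeff (mesym1 V0)) E.
  rewrite mcoeffX eqxx raddf_sum big_seq big1 ?oner_eq0 // => x /sgen[_ hx] /=.
  by rewrite (mcoeffM_lt _ hx) // mdeg_mesym1 cM.
move=> V; rewrite inE => /andP[/eqP cV VM].
(* Its Koszul boundary lies in J because x^V times any variable outside V does. *)
pose u W : 'rV[S]_(chain_rank F 0) :=
  const_mx (if W == ~: V then 'X_[mesym1 V] else 0).
pose e j := if j is 0 then t else 1%N.
have u_coef W b m : (u W 0 b)@_m = ((W == ~: V) && (mesym1 V == m))%:R.
  by rewrite mxE; case: eqP => _; rewrite ?mcoeffX ?mcoeff0.
have [||||||h [h' hE]] := @kosv_zigzag K n (chain_rank F) e (chain_map F) _ _ _ (n - d) 0 u.
- case=> [|j] a b /=; first by rewrite ord1 -[t]add0n -(shiftE _ a); exact: gr_aug.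
  have [->|[c]] := gr_diff j a b; first exact: dhomog0.
  by rewrite !shiftE addSn -add1n => /addIn->.
- by [].
- by case=> [|j] x; [exact: res2 | exact: res3].
- move=> W b _ m dm; rewrite u_coef; case: eqP => [_|//]; case: eqP => // E.
  by move: dm; rewrite -E mdeg_mesym1 cV ltnNge le_td.
- move=> W b _; rewrite u_coef; case: eqP => [_|//]; case: eqP => // E.
  by move: d_gt0; rewrite -cV -mdeg_mesym1 E mdeg0.
- move=> W cW; suff /res1[x xE] : J (kosv u W 0 0).
    by exists x; apply/rowP=> b; rewrite ord1 xE.
  apply/JM=> m; rewrite mcoeff_msupp mxE mcoeff_kos => nz.
  have /existsP[w /and4P[wW mw /eqP wWV /eqP E]] : [exists w,
      [&& w \notin W, m w != 0%N, w |: W == ~: V & mesym1 V == (m - U_(w))%MM]].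
    apply: contraNT nz => /existsPn none; apply/eqP; apply: big1 => w wW.
    have := none w; rewrite wW u_coef /=; case: eqP => _; first by rewrite mulr0.
    by rewrite /= => /negPf->; rewrite mulr0.
  have wV : w \notin V by rewrite -in_setC -wWV setU11.
  have [|V' V'M sV'] := M1 (w |: V); first by rewrite cardsU1 wV cV.
  exists V' => //.
  rewrite -(submK (m := U_(w)%MM) (m' := m)) ?lep1mP // -E addmC -mesym1U1 //.
  by rewrite mesym1_le.
pose y Y := parity V * parity Y * (h (~: Y) 0 0)@_(mesym1 Y).
exists y => V'; rewrite inE => /andP[/eqP cV' V'M].
have cCV' : #|~: V'| = (n - d)%N.
  by have := cardsC V'; rewrite card_ord cV' => E; rewrite -[in RHS]E addKn.
have := congr1 (fun x : 'rV[S]_1 => (x 0 0)@_(mesym1 V')) (hE _ cCV').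
rewrite u_coef mxE mcoeffD (inj_eq (@setC_inj _)) (inj_eq (@inj_mesym1 _)).
rewrite (eq_sym V) andbb => E.
(* A generator dividing x^V' has the same degree, so it would equal x^V', but [V'] is not in [M]. *)
have J0 : ((h' (~: V') *m chain_map F 0) 0 0)@_(mesym1 V') = 0.
  apply/eqP; rewrite mcoeff_eq0; apply: contra V'M => V'supp.
  have /JM/(_ _ V'supp)[V1 V1M] : J ((h' (~: V') *m chain_map F 0) 0 0).
    by apply/res1; exists (h' (~: V')).
  rewrite mesym1_le => sV1; suff <- : V1 = V' by [].
  by apply/eqP; rewrite eqEcard sV1 cV' cM ?leqnn.
have par_eq : parity V * parity V' * (V' == V)%:R = (V' == V)%:R.
  by case: eqP => [->|_]; rewrite ?parity_sqr ?mulr0 ?mulr1.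
rewrite -par_eq E J0 addr0 mxE mcoeff_kos mulr_sumr /cob.
apply: eq_big => w; first by rewrite inE negbK.
move=> wV'; rewrite mnmE wV' /= mesym1D1 // /y.
have -> : w |: ~: V' = ~: (V' :\ w) by rewrite setCD setUC.
rewrite (parityD1 wV') -(sgnC wV').
set c := mcoeff _ _; set s := sgn _ _ (V' :\ w); set s' := sgn _ _ (~: V').
by rewrite -[LHS]mul1r -(sgn_sqr K w (~: V') : s' * s' = 1); ring.
Qed.

End Necessity.

(** * Scalar linear equations over a polynomial ring *)

Lemma mcoeffMC (n : nat) (K : comNzRingType) (p : {mpoly K[n]}) c m :
  (p * c%:MP)@_m = p@_m * c.
Proof. by rewrite mulrC mcoeffCM mulrC. Qed.

Section ScalarEquations.
Variables (K : fieldType) (n : nat) (T T' : finType) (C : T -> T' -> K).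
Local Notation S := {mpoly K[n]}.

(** The coefficients [C] are in K, so a K-basis of the left kernel is also a basis of the S-module
    of solutions in S. *)
Definition eqn_mx : 'M[K]_(#|T|, #|T'|) := \matrix_(i, j) C (enum_val i) (enum_val j).
Definition sol_rank := \rank (kermx eqn_mx).
Definition sol_basis (a : 'I_sol_rank) (t : T) : K :=
  row_base (kermx eqn_mx) a (enum_rank t).
Definition sol_coord (f : T -> S) (a : 'I_sol_rank) : S :=
  \sum_t f t * (pinvmx (row_base (kermx eqn_mx)) (enum_rank t) a)%:MP.

Lemma sum_enum_val (R : nmodType) (I : finType) (F : I -> R) :
  \sum_(i < #|I|) F (enum_val i) = \sum_t F t.
Proof. by rewrite [RHS](reindex _ (onW_bij _ (enum_val_bij I))). Qed.

Lemma sol_basisP a t' : \sum_t sol_basis a t * C t t' = 0.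
Proof.
have /eqP : row_base (kermx eqn_mx) *m eqn_mx = 0.
  by apply/sub_kermxP; rewrite eq_row_base.
move=> /eqP/matrixP/(_ a (enum_rank t')); rewrite !mxE => E.
rewrite -[RHS]E -[LHS]sum_enum_val; apply: eq_bigr => i _.
by rewrite /sol_basis enum_valK !mxE enum_rankK.
Qed.

Lemma sol_coord_basis a b : sol_coord (fun t => (sol_basis a t)%:MP) b = (a == b)%:R.
Proof.
have /matrixP/(_ a b) := mulmxVp (row_base_free (kermx eqn_mx)).
rewrite !mxE => E; rewrite -[in RHS](rmorph_nat (@mpolyC n K)) -E.
rewrite rmorph_sum /sol_coord -sum_enum_val; apply: eq_bigr => i _ /=.
by rewrite -rmorphM /sol_basis enum_valK.
Qed.

(** For each monomial [m], the coefficients of [f] at [m] form a solution over K, hence lie in the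
    row space of the basis. *)
Lemma sol_coordK (f : T -> S) :
    (forall t', \sum_t f t * (C t t')%:MP = 0) ->
  forall t, f t = \sum_a sol_coord f a * (sol_basis a t)%:MP.
Proof.
move=> feq t; apply/mpolyP=> m; set B := row_base (kermx eqn_mx).
pose x : 'rV[K]_#|T| := \row_i (f (enum_val i))@_m.
have xB : (x <= B)%MS.
  rewrite eq_row_base; apply/sub_kermxP/rowP=> j; rewrite !mxE.
  have := congr1 (mcoeff m) (feq (enum_val j)); rewrite mcoeff0 => E.
  apply: etrans E; rewrite raddf_sum -[RHS]sum_enum_val; apply: eq_bigr => i _ /=.
  by rewrite mcoeffMC !mxE.
have /rowP/(_ (enum_rank t)) := mulmxKpV xB.
rewrite !mxE enum_rankK => <-; rewrite raddf_sum; apply: eq_bigr => a _ /=.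
rewrite mcoeffMC; congr (_ * _); rewrite !mxE raddf_sum -[RHS]sum_enum_val.
by apply: eq_bigr => i _ /=; rewrite mcoeffMC mxE enum_valK.
Qed.

Lemma eq_sol_coord (f g : T -> S) : f =1 g -> sol_coord f =1 sol_coord g.
Proof. by move=> fg a; apply: eq_bigr => t _; rewrite fg. Qed.

Lemma sol_coord_sum r (u : 'I_r -> S) (F : 'I_r -> T -> S) b :
  sol_coord (fun t => \sum_a u a * F a t) b = \sum_a u a * sol_coord (F a) b.
Proof.
rewrite /sol_coord; under eq_bigr do rewrite mulr_suml.
rewrite exchange_big; apply: eq_bigr => a _; rewrite mulr_sumr.
by apply: eq_bigr => t _; rewrite mulrA.
Qed.

Lemma sol_coord_comb (u : 'I_sol_rank -> S) b :
  sol_coord (fun t => \sum_a u a * (sol_basis a t)%:MP) b = u b.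
Proof.
rewrite sol_coord_sum (bigD1 b) //= sol_coord_basis eqxx mulr1.
by rewrite big1 ?addr0 // => a /negPf ab; rewrite sol_coord_basis ab mulr0.
Qed.

End ScalarEquations.

(** * Monomial ideals *)

Section MonomialIdeals.
Variables (K : fieldType) (n : nat).
Local Notation S := {mpoly K[n]}.
Implicit Types (v w : 'I_n) (U V W X : {set 'I_n}) (M : {set {set 'I_n}}).

Lemma ideal_gen_sum (G : S -> Prop) (I : Type) (s : seq I) (P : pred I) (F : I -> S) :
  (forall i, P i -> ideal_gen G (F i)) -> ideal_gen G (\sum_(i <- s | P i) F i).
Proof.
move=> FG; apply: (big_ind (ideal_gen G)) => [|_ _ [s1 s1G ->] [s2 s2G ->]|//].
  by exists [::]; rewrite ?big_nil.
exists (s1 ++ s2); last by rewrite big_cat.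
by move=> x; rewrite mem_cat => /orP[/s1G|/s2G].
Qed.

Lemma ideal_genM (G : S -> Prop) a g : G g -> ideal_gen G (a * g).
Proof.
move=> Gg; exists [:: (a, g)]; rewrite ?big_seq1 // => x.
by rewrite inE => /eqP->.
Qed.

Lemma msuppM_dvd (p q : S) m : m \in msupp (p * q) ->
  exists m1 m2, [/\ m1 \in msupp p, m2 \in msupp q & m = (m1 + m2)%MM].
Proof.
by move/msuppM_le/allpairsP=> [[m1 m2] /= [? ? ->]]; exists m1, m2.
Qed.

Lemma msupp_sum_mem (I : eqType) (s : seq I) (F : I -> S) m :
  m \in msupp (\sum_(i <- s) F i) -> exists2 i, i \in s & m \in msupp (F i).
Proof.
move/msupp_sum_le/flatten_mapP=> [i]; rewrite filter_predT => si mi.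
by exists i.
Qed.

Lemma ideal_gen_monoP (G : 'X_{1..n} -> Prop) (f : S) :
  ideal_gen (fun g => exists2 m, G m & g = 'X_[m]) f <->
  forall m, m \in msupp f -> exists2 m', G m' & (m' <= m)%MM.
Proof.
split=> [[s sG ->] m /msupp_sum_mem[x /sG[m' Gm' ->]]|fG].
  move=> /msuppM_dvd[m1 [m2 [_]]]; rewrite msuppX inE => /eqP-> ->.
  by exists m' => //; exact: lem_addl.
rewrite [f]mpolyE big_seq; apply: ideal_gen_sum => m /fG[m' Gm' le].
rewrite -(submK le) mpolyXD scalerAl; apply: ideal_genM; by exists m'.
Qed.

Lemma monomial_ideal_sumP (J : S -> Prop) M f : monomial_ideal J M ->
  J f <-> exists g, f = \sum_(V in M) 'X_[mesym1 V] * g V.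
Proof.
move=> JM; rewrite JM; split=> [fM|[g -> m]]; last first.
  rewrite mcoeff_msupp raddf_sum /= => nz.
  have /existsP[V /andP[VM]] : [exists V in M, m \in msupp ('X_[mesym1 V] * g V)].
    apply: contraNT nz => /existsPn none; apply/eqP; apply: big1 => V VM.
    by have := none V; rewrite VM => /memN_msupp_eq0.
  move=> /msuppM_dvd[m1 [m2 [+ _ ->]]]; rewrite msuppX inE => /eqP->.
  by exists V => //; exact: lem_addr.
(* Each monomial of [f] is assigned to one generator dividing it, so that it is counted once. *)
pose ch (m : 'X_{1..n}) := [pick V in M | (mesym1 V <= m)%MM].
exists (fun V => \sum_(m <- msupp f | ch m == Some V) f@_m *: 'X_[m - mesym1 V]).
under eq_bigr do rewrite mulr_sumr.
rewrite (exchange_big_dep predT) //= [LHS]mpolyE big_seq [RHS]big_seq.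
apply: eq_bigr => m /fM[V0 V0M le0]; rewrite /ch.
case: pickP => [V /andP[VM le]|/(_ V0)]; last by rewrite V0M le0.
rewrite (big_pred1 V) => [|V']; last first.
  by rewrite /= (inj_eq Some_inj) eq_sym; case: eqP => [->|]; rewrite ?VM ?andbF.
by rewrite -scalerAr -mpolyXD addmC submK.
Qed.

Lemma monomial_ideal_generated (J : S -> Prop) M d : monomial_ideal J M ->
  (forall V, V \in M -> #|V| = d) -> generated_in_degree d J.
Proof.
move=> JM cM f; split=> [/(monomial_ideal_sumP _ JM)[g ->]|[s sJ ->]].
  apply: ideal_gen_sum => V VM; rewrite mulrC; apply: ideal_genM; split.
    by apply/JM=> m; rewrite msuppX inE => /eqP->; exists V; rewrite ?lepm_refl.
  by rewrite dhomogX /= mdeg_mesym1 cM.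
apply/JM=> m /msupp_sum_mem[x /sJ[/JM xM _]].
move=> /msuppM_dvd[m1 [m2 [_ /xM[V VM le] ->]]].
by exists V => //; apply: lepm_trans le (lem_addl _ _).
Qed.

End MonomialIdeals.

(** * The linear strand *)

Section Strand.
Variables (K : fieldType) (n : nat) (M : {set {set 'I_n}}) (d : nat).
Local Notation S := {mpoly K[n]}.
Implicit Types (v w : 'I_n) (U V W X : {set 'I_n}).
Implicit Types (f g h : {set 'I_n} -> {set 'I_n} -> S).

Definition admissible i W V := [&& #|W| == (d + i)%N, V \in M & V \subset W].

(* The S-module of these f is F_i, free since the equations have coefficients
   in K: f W V is the coefficient of the Koszul chain indexed by W \ V tensor
   x^V, and the [cob] equations say that the Koszul boundary in J vanishes. *)
Definition strand i f :=
  (forall W V, ~~ admissible i W V -> f W V = 0) /\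
  (forall W U, #|W| = (d + i)%N -> U \subset W -> #|U| = d.+1 -> cob (f W) U = 0).

(** The conditions of [strand] as one finite linear system: [inl] for the vanishing entries, [inr]
    for the coboundaries, with a zero equation wherever nothing is imposed. *)
Definition strand_eqn i (t : {set 'I_n} * {set 'I_n})
    (e : ({set 'I_n} * {set 'I_n}) + ({set 'I_n} * {set 'I_n})) : K :=
  match e with
  | inl p => if admissible i p.1 p.2 then 0 else (t == p)%:R
  | inr p => if [&& #|p.1| == (d + i)%N, p.2 \subset p.1 & #|p.2| == d.+1]
             then cob (fun V => (t == (p.1, V))%:R) p.2 else 0
  end.

Lemma sum_delta (f : {set 'I_n} * {set 'I_n} -> S) p :
  \sum_t f t * ((t == p)%:R : K)%:MP = f p.
Proof.
rewrite (bigD1 p) //= eqxx mulr1 big1 ?addr0 // => t /negPf->.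
by rewrite mpolyC0 mulr0.
Qed.

Lemma strandP i f :
  strand i f <-> forall e, \sum_t f t.1 t.2 * (strand_eqn i t e)%:MP = 0.
Proof.
have sum_cob W U : \sum_t f t.1 t.2 *
    (cob (fun V => ((t == (W, V))%:R : K)) U)%:MP = cob (f W) U.
  transitivity (cob (fun V => \sum_t f t.1 t.2 * ((t == (W, V))%:R : K)%:MP) U).
    by rewrite cob_sum; apply: eq_bigr => t _; rewrite cobZ cob_mpolyC.
  by apply: eq_cob => v _; rewrite (sum_delta (fun t => f t.1 t.2)).
split=> [[f0 fcob] [[W V]|[W U]]|feq]; last split=> [W V /negPf adm|W U cW sUW cU].
- rewrite /strand_eqn /=; have [adm|adm] := boolP (admissible i W V).
    by apply: big1 => t _; rewrite mpolyC0 mulr0.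
  by rewrite (sum_delta (fun t => f t.1 t.2)) f0.
- rewrite /strand_eqn /=.
  have [/and3P[/eqP cW sUW /eqP cU]|_] := boolP [&& #|W| == _, _ & _].
    by rewrite sum_cob fcob.
  by apply: big1 => t _; rewrite mpolyC0 mulr0.
- have := feq (inl (W, V)); rewrite /strand_eqn /= adm.
  by rewrite (sum_delta (fun t => f t.1 t.2)).
by have := feq (inr (W, U)); rewrite /strand_eqn /= cW sUW cU !eqxx /= sum_cob.
Qed.

Definition srank i := sol_rank (strand_eqn i).

Definition sbasis i (a : 'I_(srank i)) W V : S :=
  (sol_basis (C := strand_eqn i) a (W, V))%:MP.

Definition scoord i f : 'rV[S]_(srank i) :=
  \row_a sol_coord (C := strand_eqn i) (fun t => f t.1 t.2) a.

Definition scomb i (u : 'rV[S]_(srank i)) W V : S :=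
  \sum_a u 0 a * sbasis a W V.

Lemma sbasis_strand i (a : 'I_(srank i)) : strand i (sbasis a).
Proof.
apply/strandP=> e; rewrite -[RHS](mpolyC0 n K) -(sol_basisP a e) rmorph_sum.
by apply: eq_bigr => -[W V] _; rewrite rmorphM.
Qed.

Lemma scomb_strand i (u : 'rV[S]_(srank i)) : strand i (scomb u).
Proof.
split=> [W V adm|W U cW sUW cU].
  by apply: big1 => a _; have [-> //] := sbasis_strand a; rewrite mulr0.
rewrite cob_sum; apply: big1 => a _; rewrite cobZ.
by have [_ -> //] := sbasis_strand a; rewrite mulr0.
Qed.

Lemma scoordK i f : strand i f -> forall W V, scomb (scoord i f) W V = f W V.
Proof.
move=> /strandP feq W V.
apply: etrans (esym (sol_coordK (f := fun t => f t.1 t.2) feq (W, V))).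
by apply: eq_bigr => a _; rewrite mxE.
Qed.

Lemma scombK i (u : 'rV[S]_(srank i)) : scoord i (scomb u) = u.
Proof.
apply/rowP=> a; rewrite mxE -[RHS](sol_coord_comb (C := strand_eqn i) (u 0)).
by apply: eq_sol_coord => -[W V].
Qed.

Lemma eq_scoord i f g : (forall W V, f W V = g W V) -> scoord i f = scoord i g.
Proof. by move=> fg; apply/rowP=> a; rewrite !mxE; apply: eq_sol_coord => t. Qed.

(** The test on [V] discards the terms [f (w |: W) V] with [w] in [V], which [kos] alone would
    include. *)
Definition sdiff f W V : S := if V \subset W then kos (f^~ V) W else 0.

Lemma sdiff_strand i f : strand i.+1 f -> strand i (sdiff f).
Proof.
move=> [f0 fcob]; split=> [W V adm|W U cW sUW cU].
  rewrite /sdiff; case: ifP => // sVW; rewrite -[RHS](kos0 K W).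
  apply: eq_kos => w wW; apply: f0; apply: contra adm => /and3P[+ VM _].
  by rewrite /admissible VM sVW cardsU1 wW addnS eqSS => ->.
rewrite (@eq_cob _ _ _ (fun V => kos (f^~ V) W)) => [|v vU]; last first.
  by rewrite /sdiff (subset_trans (subD1set _ _) sUW).
rewrite cob_kos -[RHS](kos0 K W); apply: eq_kos => w wW; apply: fcob => //.
  by rewrite cardsU1 wW cW addnS.
exact: subset_trans sUW (subsetUr _ _).
Qed.

Lemma sdiff_sdiff f W V : sdiff (sdiff f) W V = 0.
Proof.
rewrite /sdiff; case: ifP => // sVW; rewrite -[RHS](kos_kos (f^~ V) W).
by apply: eq_kos => w _; rewrite (subset_trans sVW (subsetUr _ _)).
Qed.

Definition sdiff_mx i : 'M[S]_(srank i.+1, srank i) :=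
  \matrix_(a, b) scoord i (sdiff (sbasis a)) 0 b.

Lemma scomb_mulmx i (u : 'rV[S]_(srank i.+1)) W V :
  scomb (u *m sdiff_mx i) W V = sdiff (scomb u) W V.
Proof.
rewrite -(scoordK (sdiff_strand (scomb_strand u))); congr (scomb _ W V).
apply/rowP=> b; rewrite !mxE.
under eq_bigr do rewrite !mxE.
rewrite -sol_coord_sum; apply: eq_sol_coord => -[X Y] /=; rewrite /sdiff.
case: ifP => _; last by rewrite big1 // => a _; rewrite mulr0.
by under eq_bigr do rewrite -kosZ; rewrite -kos_sum.
Qed.

Definition saug_mx : 'cV[S]_(srank 0) :=
  \col_a \sum_(V in M) 'X_[mesym1 V] * sbasis a V V.

Lemma saug_mulmx (u : 'rV[S]_(srank 0)) :
  (u *m saug_mx) 0 0 = \sum_(V in M) 'X_[mesym1 V] * scomb u V V.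
Proof.
rewrite mxE; under eq_bigr do rewrite mxE mulr_sumr.
rewrite exchange_big; apply: eq_bigr => V _ /=; rewrite mulr_sumr.
by apply: eq_bigr => a _; rewrite mulrCA.
Qed.

Lemma scoord_homog i f e :
  (forall W V, f W V \is e.-homog) -> forall a, scoord i f 0 a \is e.-homog.
Proof.
move=> fh a; rewrite mxE; apply: rpred_sum => t _.
by rewrite mulrC mul_mpolyC; apply: dhomogZ.
Qed.

Lemma sdiff_mx_homog i a b : sdiff_mx i a b \is 1.-homog.
Proof.
rewrite mxE; apply: scoord_homog => W V; rewrite /sdiff.
case: ifP => _; last exact: dhomog0.
apply: rpred_sum => w _; rewrite mulrC mul_mpolyC sgn_mpolyC mul_mpolyC.
by do 2![apply: dhomogZ]; rewrite dhomogX /= mdeg1.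
Qed.

Hypothesis cM : forall V, V \in M -> #|V| = d.

Lemma saug_mx_homog a b : saug_mx a b \is d.-homog.
Proof.
rewrite mxE; apply: rpred_sum => V VM; rewrite mulrC mul_mpolyC.
by apply: dhomogZ; rewrite dhomogX /= mdeg_mesym1 cM.
Qed.

Lemma sum_diag_strand f : strand 0 f ->
  \sum_(V in M) 'X_[mesym1 V] * f V V =
  \sum_(V : {set 'I_n} | #|V| == d) 'X_[mesym1 V] * f V V.
Proof.
move=> [f0 _]; rewrite [RHS](bigID (mem M)) /= [X in _ + X]big1 ?addr0.
  by apply: eq_bigl => V; case: (boolP (V \in M)) => [/cM->|]; rewrite ?eqxx ?andbF.
by move=> V /andP[_ VM]; rewrite f0 ?mulr0 // /admissible (negPf VM) andbF.
Qed.

(** By [sum_kos_cob] the sum becomes one of coboundaries [cob (f W) W] with [W] of size [d.+1], all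
    zero on a strand. *)
Lemma saug_sdiff f : strand 1 f -> \sum_(V in M) 'X_[mesym1 V] * sdiff f V V = 0.
Proof.
move=> fs; rewrite sum_diag_strand; last exact: sdiff_strand.
rewrite (eq_bigr (fun V => 'X_[mesym1 V] * kos (f^~ V) V)) => [|V _]; last first.
  by rewrite /sdiff subxx.
rewrite sum_kos_cob; apply: big1 => W /eqP cW.
by have [_ ->] := fs; rewrite ?mulr0 ?addn1.
Qed.

Hypothesis sepM :
  cob_separates K [set V : {set 'I_n} | (#|V| == d) && (V \notin M)].

Lemma strand_exact i f : strand i f ->
    (i = 0%N -> \sum_(V in M) 'X_[mesym1 V] * f V V = 0) ->
    ((0 < i)%N -> forall W V, sdiff f W V = 0) ->
  exists2 h, strand i.+1 h & forall W V, sdiff h W V = f W V.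
Proof.
move=> fs faug fdiff; have [f0 fcob] := fs.
have [V||||||h [hcob hkos hB]] := @cocycle_exact_on K n _ d (d + i) f _ sepM.
- by rewrite inE => /andP[/eqP].
- exact: leq_addr.
- exact: fcob.
- move=> W V cW sVW cV; case: (posnP i) => [i0|/fdiff/(_ W V)]; last first.
    by rewrite /sdiff sVW.
  by move: (subset_leq_card sVW); rewrite cV -ltnS cW i0 addn0 ltnn.
- move=> di; have i0 : i = 0%N by lia.
  by rewrite -[RHS](faug i0) sum_diag_strand // -[X in strand X]i0.
- move=> W V cW sVW; rewrite inE => /andP[_ VM]; apply: f0.
  by rewrite /admissible (negPf VM) andbF.
(* Cutting [h] down to admissible pairs preserves the coboundary equations, since [h] vanishes on
   the sets of size [d] outside [M]. *)
pose h' W V := if admissible i.+1 W V then h W V else 0.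
have h's : strand i.+1 h'.
  split=> [W V /negPf|W U cW sUW cU]; first by rewrite /h' => ->.
  rewrite -[RHS](hcob W U) -?addnS //; apply: eq_cob => v vU.
  have sUvW := subset_trans (subD1set U v) sUW.
  have cUv : #|U :\ v| = d by move: cU; rewrite (cardsD1 v) vU => -[].
  rewrite /h' /admissible cW eqxx sUvW andbT /=; case: (boolP (_ \in _)) => // UvM.
  by rewrite hB ?inE ?cUv ?eqxx //= cW addnS.
exists h' => // W V; case: (boolP (admissible i W V)) => [|adm]; last first.
  by rewrite f0 //; have [-> //] := sdiff_strand h's.
move=> /and3P[/eqP cW VM sVW]; rewrite /sdiff sVW (hkos W V cW sVW (cM VM)).
apply: eq_kos => w wW; rewrite /h' /admissible VM cardsU1 wW cW addnS eqxx /=.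
by rewrite (subset_trans sVW (subsetUr _ _)).
Qed.

Definition strand_seq : free_seq K n :=
  @FreeSeq K n srank (fun i _ => (i + d)%N) sdiff_mx saug_mx.

Lemma strand_seq_resolves J : monomial_ideal J M -> resolves strand_seq J.
Proof.
move=> JM; split=> /=.
- move=> p; rewrite (monomial_ideal_sumP _ JM); split=> [[g ->]|[u <-]]; last first.
    by exists (fun V => scomb u V V); rewrite saug_mulmx.
  pose f W V := if (W == V) && (V \in M) then g V else 0.
  have fs : strand 0 f.
    split=> [W V|W U cW sUW cU]; last first.
      by move: (subset_leq_card sUW); rewrite cU cW addn0 ltnn.
    rewrite /f; case: ifP => // /andP[/eqP-> VM].
    by rewrite /admissible VM subxx cM // addn0 eqxx.
  exists (scoord 0 f); rewrite saug_mulmx; apply: eq_bigr => V VM.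
  by rewrite scoordK // /f eqxx VM.
- move=> u; split=> [uA|[x ->]]; last first.
    apply/rowP=> b; rewrite ord1 saug_mulmx mxE.
    rewrite -[RHS](saug_sdiff (scomb_strand x)).
    by apply: eq_bigr => V _; rewrite scomb_mulmx.
  have [|//|h hs hE] := @strand_exact 0 _ (scomb_strand u).
    by rewrite -saug_mulmx uA mxE.
  exists (scoord 1 h); rewrite -[LHS]scombK -[RHS]scombK; apply: eq_scoord => W V.
  rewrite scomb_mulmx -hE /sdiff; case: ifP => // _.
  by apply: eq_kos => w _; rewrite scoordK.
move=> i u; split=> [uA|[x ->]]; last first.
  rewrite -[LHS]scombK -[RHS]scombK; apply: eq_scoord => W V.
  rewrite scomb_mulmx /scomb [RHS]big1 => [|a _]; last by rewrite mxE mul0r.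
  rewrite -[RHS](sdiff_sdiff (scomb x) W V) {1 2}/sdiff; case: ifP => // _.
  by apply: eq_kos => w _; exact: scomb_mulmx.
have [//|_ W V|h hs hE] := @strand_exact i.+1 _ (scomb_strand u).
  by rewrite -scomb_mulmx uA /scomb big1 // => a _; rewrite mxE mul0r.
exists (scoord _ h); rewrite -[LHS]scombK -[RHS]scombK; apply: eq_scoord => W V.
rewrite scomb_mulmx -hE /sdiff; case: ifP => // _.
by apply: eq_kos => w _; rewrite scoordK.
Qed.

Lemma separates_linear (J : S -> Prop) : monomial_ideal J M -> has_linear_resolution J.
Proof.
move=> JM; exists d; split; first exact: monomial_ideal_generated JM cM.
exists strand_seq; last first.
  move=> i j ij; apply/eqP; rewrite cards_eq0; apply/eqP/setP=> a.
  by rewrite !inE /=; apply/eqP=> /esym.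
split; first split=> /=.
- by move=> a; exact: saug_mx_homog.
- by move=> i a b; right; exists 1%N; [rewrite add1n | exact: sdiff_mx_homog].
- exact: strand_seq_resolves.
move=> i a b; apply: (dhomog_nemf_coeff (sdiff_mx_homog a b)).
by rewrite /= mdeg0.
Qed.

End Strand.

(** * Matchings *)

Section Matchings.
Variables (K : fieldType) (n : nat).
Local Notation S := {mpoly K[n]}.
Implicit Types (U V W X : {set 'I_n}) (E : {set {set 'I_n}}).

(** [V] is the vertex set of a [q]-matching in [E], whose edges are removed one by one. *)
Fixpoint matched E q V : bool :=
  if q is r.+1 then [exists e in E, (e \subset V) && matched E r (V :\: e)]
  else V == set0.

Definition matched_sets E q := [set V | matched E q V].

Lemma matchedU E q e V : e \in E -> [disjoint e & V] -> matched E q V ->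
  matched E q.+1 (e :|: V).
Proof.
move=> eE dis mV; apply/existsP; exists e; rewrite eE subsetUl /=.
rewrite setDUl setDv set0U; suff -> : V :\: e = V by [].
by apply/setDidPl; rewrite disjoint_sym.
Qed.

Section Edges.
Variable E : {set {set 'I_n}}.
Hypothesis cE : forall e, e \in E -> #|e| = 2%N.

Lemma card_matched q V : matched E q V -> #|V| = q.*2.
Proof.
elim: q V => [V /eqP->|q IH V /existsP[e /and3P[eE sV /IH]]]; first exact: cards0.
by rewrite (cardsDS sV) (cE eE); have := subset_leq_card sV; rewrite (cE eE); lia.
Qed.

Lemma matched_matching_number q :
  (q <= matching_number E)%N -> exists V, matched E q V.
Proof.
move=> le_q; have [Q /andP[QE trQ] le_qQ] : exists2 Q : {set {set 'I_n}},
    (Q \subset E) && trivIset Q & (q <= #|Q|)%N.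
  (* The maximum is bounded by [q.-1] below, which contradicts [le_q] only for positive [q]. *)
  case: (posnP q) => [->|q_gt0].
    by exists set0; rewrite // sub0set; apply/trivIsetP=> A B; rewrite inE.
  apply/exists_inP; apply: contraLR le_q => /exists_inPn none.
  rewrite -ltnNge -(prednK q_gt0) ltnS; apply/bigmax_leqP => Q /none.
  by rewrite -ltnNge -{1}(prednK q_gt0).
suff [V] : exists2 V, matched E q V & V \subset cover Q by exists V.
elim: q Q {le_q} QE trQ le_qQ => [|q IH] Q QE trQ le_qQ.
  by exists set0; rewrite ?sub0set /=.
have /set0Pn[e eQ] : Q != set0 by rewrite -card_gt0; apply: leq_trans le_qQ.
have [|||V mV sV] := IH (Q :\ e).
- exact: subset_trans (subD1set _ _) QE.
- exact: trivIsetS (subD1set _ _) trQ.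
- by move: le_qQ; rewrite (cardsD1 e) eQ.
have dis : [disjoint e & V].
  apply: disjointWr sV _; apply/bigcup_disjointP => f.
  by rewrite !inE => /andP[fe fQ]; rewrite (trivIsetP trQ) // eq_sym.
exists (e :|: V); first by apply: matchedU => //; apply: (subsetP QE).
rewrite subUset (bigcup_sup e) //=; apply: subset_trans sV _.
by apply/bigcupsP=> f; rewrite !inE => /andP[_ fQ]; apply: bigcup_sup.
Qed.

Hypothesis E3 : forall U, #|U| = 3%N -> exists2 e, e \in E & e \subset U.

Lemma edge_sub U : (2 < #|U|)%N -> exists2 e, e \in E & e \subset U.
Proof.
move=> cU; have [A sAU cA] : exists2 A : {set 'I_n}, A \subset U & #|A| = 3%N.
  have /card_gt2P[x [y [z [[xU yU zU] [xy yz zx]]]]] := cU.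
  exists (x |: (y |: [set z])); first by rewrite !subUset !sub1set xU yU.
  by rewrite !cardsU1 cards1 !inE (eq_sym x z) (negPf xy) (negPf yz) (negPf zx).
by have [e eE sA] := E3 cA; exists e => //; apply: subset_trans sA sAU.
Qed.

(** Greedy choice: as long as three points remain they contain an edge, and each edge uses up two
    points. *)
Lemma matched_sub q U : #|U| = (q.*2).+1 -> exists2 V, matched E q V & V \subset U.
Proof.
elim: q U => [|q IH] U cU; first by exists set0; rewrite ?sub0set /=.
have [|e eE sU] := @edge_sub U; first by rewrite cU.
have [|V mV sV] := IH (U :\: e).
  by rewrite (cardsDS sU) (cE eE) cU.
move: sV; rewrite subsetD => /andP[sVU dis].
exists (e :|: V); last by rewrite subUset sU.
by apply: matchedU => //; rewrite disjoint_sym.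
Qed.

Definition unmatched q :=
  [set V : {set 'I_n} | (#|V| == q.*2) && (V \notin matched_sets E q)].

Lemma cob_separates_wedge q : (0 < q)%N ->
  cob_separates K (unmatched q) -> cob_separates K (unmatched q.+1).
Proof.
move=> q_gt0 sep V; rewrite !inE => /andP[/eqP cV mV].
have [|e eE sV] := @edge_sub V; first by rewrite cV; lia.
(* A [q]-matching of [X :\: e] would extend by [e] to a matching of [X]. *)
have unm X : e \subset X -> #|X| = q.+1.*2 -> ~~ matched E q.+1 X ->
    X :\: e \in unmatched q.
  move=> sX cX mX; rewrite !inE (cardsDS sX) cX (cE eE); apply/andP; split.
    by apply/eqP; lia.
  by apply: contra mX => mX; apply/existsP; exists e; rewrite eE sX.
have [y yE] := sep _ (unm V sV cV mV).
have /cards2P[a [b [ab e_ab]]] : #|e| == 2%N by rewrite cE.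
(* The two sign changes of [cob_wedge] cancel, and the coboundary vanishes on sets not containing
   [e]. *)
have cob_y X : cob (wedge a (wedge b y)) X =
    if e \subset X then sgn K a (X :\ a) * sgn K b (X :\ a :\ b) * cob y (X :\: e) else 0.
  rewrite !cob_wedge e_ab subUset !sub1set; case: ifP => //= aX.
  rewrite !inE (eq_sym b) ab /=; case: ifP => bX; last by rewrite mulr0 oppr0.
  by rewrite mulrN opprK mulrA setDDl.
exists (fun X => sgn K a (V :\ a) * sgn K b (V :\ a :\ b) * wedge a (wedge b y) X).
move=> V'; rewrite !inE => /andP[/eqP cV' mV']; rewrite cobZ cob_y.
case: ifP => [sV'|sV']; last first.
  by rewrite mulr0; case: eqP sV' => [->|//]; rewrite sV.
rewrite yE ?unm //; case: (V' =P V) => [->|V'V].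
  by rewrite eqxx mulr1 mulrACA !sgn_sqr mulr1.
case: eqP => [E'|]; last by rewrite !mulr0.
by case: V'V; rewrite -(setID V e) -(setID V' e) E' (setIidPr sV) (setIidPr sV').
Qed.

End Edges.
End Matchings.

(** * Squarefree powers *)

Section SquarefreePowers.
Variables (K : fieldType) (n : nat).
Local Notation S := {mpoly K[n]}.
Implicit Types (A U V W : {set 'I_n}) (m : 'X_{1..n}).

Lemma prod_mpolyX A : \prod_(i in A) 'X_i = 'X_[mesym1 A] :> S.
Proof.
rewrite mpolyXE_id big_mkcond; apply: eq_bigr => i _; rewrite mnmE.
by case: ifP => _; rewrite ?expr1 ?expr0.
Qed.

(** * Powers of an ideal generated by edges *)

Section Power.
Variables (E : {set {set 'I_n}}) (J : S -> Prop).
Hypothesis cE : forall e, e \in E -> #|e| = 2%N.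
Hypothesis E_J : forall e, e \in E -> J 'X_[mesym1 e].
Hypothesis J_E : forall f, J f ->
  forall m, m \in msupp f -> exists2 e, e \in E & (mesym1 e <= m)%MM.

(** Divisibility of x^m by a product of [q] edges; unlike in [matched], the edges may meet or
    repeat. *)
Fixpoint edge_power q m : Prop :=
  if q is r.+1 then exists e, [/\ e \in E, (mesym1 e <= m)%MM &
    edge_power r (m - mesym1 e)%MM] else True.

Lemma edge_power_le q m m' : (m <= m')%MM -> edge_power q m -> edge_power q m'.
Proof.
elim: q m m' => //= q IH m m' le [e [eE le_e em]].
exists e; split=> //; first exact: lepm_trans le_e le.
apply: IH em; apply/mnm_lepP=> i; rewrite !mnmBE.
by apply: leq_sub2r; apply: (mnm_lepP le).
Qed.

Lemma edge_power_prod (t : seq S) m : (forall g, g \in t -> J g) ->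
  m \in msupp (\prod_(g <- t) g) -> edge_power (size t) m.
Proof.
elim: t m => [//|g t IH] m tJ; rewrite big_cons => /msuppM_dvd[m1 [m2 [gm1 tm2 ->]]].
have [e eE le] := J_E (tJ g (mem_head g t)) gm1.
exists e; split=> //; first exact: lepm_trans le (lem_addr _ _).
apply: edge_power_le (IH m2 _ tm2) => [|x xt]; last by apply: tJ; rewrite inE xt orbT.
apply/mnm_lepP=> i; rewrite mnmBE mnmDE.
by have := mnm_lepP le i; lia.
Qed.

Lemma ideal_pow_edge_power q f m :
  ideal_pow J q f -> m \in msupp f -> edge_power q m.
Proof.
move=> [s sJ ->] /msupp_sum_mem[x /sJ[t tJ ->]] /msuppM_dvd[m1 [m2 [_ tm2 ->]]].
by apply: edge_power_le (lem_addl _ _) _; rewrite -(size_tuple t); apply: edge_power_prod tm2.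
Qed.

(** A vertex shared by two of the edges would have exponent at least two in [m]. *)
Lemma edge_power_matched q m : squarefree m -> edge_power q m ->
  exists2 V, matched E q V & (mesym1 V <= m)%MM.
Proof.
elim: q m => [|q IH] m sqm.
  by exists set0 => /=; rewrite ?eqxx //; apply/mnm_lepP=> i; rewrite mnmE inE.
move=> [e [eE le_e em]].
have [|V mV le_V] := IH _ _ em.
  by move=> i; rewrite mnmBE; apply: leq_trans (leq_subr _ _) (sqm i).
have le_eV i : ((i \in e) + (i \in V) <= m i)%N.
  have := mnm_lepP le_V i; have := mnm_lepP le_e i; rewrite mnmBE !mnmE.
  by case: (i \in e); case: (i \in V); rewrite /=; lia.
exists (e :|: V).
  apply: matchedU => //; rewrite disjoint_subset; apply/subsetP=> i ie.
  rewrite inE; apply/negP=> iV; have := leq_trans (le_eV i) (sqm i).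
  by rewrite ie iV.
apply/mnm_lepP=> i; apply: leq_trans (le_eV i); rewrite mnmE inE.
by case: (i \in e).
Qed.

Lemma ideal_pow_matched q V : matched E q V -> ideal_pow J q 'X_[mesym1 V].
Proof.
move=> mV; have [t [ts tJ tV]] : exists t : seq S,
    [/\ size t = q, forall g, g \in t -> J g & \prod_(g <- t) g = 'X_[mesym1 V]].
  elim: q V mV => [|q IH] V.
    move/eqP->; exists [::]; split=> //; rewrite big_nil -(mpolyX0 n K).
    by congr 'X_[_]; apply/mnmP=> i; rewrite mnm0E mnmE inE.
  move=> /existsP[e /and3P[eE sV /IH[t [ts tJ tV]]]].
  exists ('X_[mesym1 e] :: t); split; rewrite ?big_cons /= ?ts //.
    by move=> g; rewrite inE => /orP[/eqP->|/tJ//]; apply: E_J.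
  rewrite tV -mpolyXD; congr 'X_[_]; apply/mnmP=> i; rewrite mnmDE !mnmE inE.
  by case: (boolP (i \in e)) => // /(subsetP sV)->.
rewrite -[X in ideal_pow J q X]mul1r; apply: ideal_genM.
by exists (Tuple (introT eqP ts)).
Qed.

(** All matched sets have size [2q], so none properly contains another; this gives minimality. *)
Lemma min_mono_gen_matched q m :
  (min_mono_gen (ideal_pow J q) m /\ squarefree m) <->
  exists2 V, matched E q V & m = mesym1 V.
Proof.
split=> [[[Jm min_m] sqm]|[V mV ->]].
  have [|V mV le] := @edge_power_matched q m sqm.
    by apply: ideal_pow_edge_power Jm _; rewrite msuppX inE.
  by exists V => //; apply/esym/min_m => //; apply: ideal_pow_matched.
have sqV : squarefree (mesym1 V) by move=> i; rewrite mnmE; case: (i \in V).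
split=> //; split=> [|m' Jm' le]; first exact: ideal_pow_matched.
have [||V' mV' le'] := @edge_power_matched q m'.
- by move=> i; apply: leq_trans (sqV i); apply: (mnm_lepP le).
- by apply: ideal_pow_edge_power Jm' _; rewrite msuppX inE.
have eV : V' = V.
  apply/eqP; rewrite eqEcard (card_matched cE mV) (card_matched cE mV') leqnn andbT.
  by rewrite -mesym1_le; apply: lepm_trans le' le.
apply/mnmP=> i; apply/eqP; rewrite eqn_leq (mnm_lepP le) /=.
by rewrite -eV (mnm_lepP le').
Qed.

Lemma sqfree_pow_monomial q : monomial_ideal (sqfree_pow J q) (matched_sets E q).
Proof.
move=> f; rewrite /sqfree_pow ideal_gen_monoP; split=> fG m /fG.
  move=> [m' /min_mono_gen_matched[V mV ->] le].
  by exists V; rewrite ?inE.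
move=> [V]; rewrite inE => mV le; exists (mesym1 V) => //.
by apply/min_mono_gen_matched; exists V.
Qed.

End Power.

(** * Stanley--Reisner ideals of flag complexes *)

Section Flag.
Variable D : {set {set 'I_n}}.
Hypotheses (hD : simplicial_complex D) (hflag : flag K D).

Lemma card_complement_edge e : e \in complement_edges D -> #|e| = 2%N.
Proof. by rewrite inE => /andP[/eqP]. Qed.

Lemma card_nonface A : A \notin D -> (1 < #|A|)%N.
Proof.
have [D0 D1 _] := hD; move=> AD; rewrite ltnNge; apply: contra AD => cA.
have [->//|] := eqVneq A set0; rewrite -card_gt0 => A0.
have /cards1P[i ->] : #|A| == 1%N by rewrite eqn_leq cA.
exact: D1.
Qed.

Lemma stanley_reisner_nonface A : A \notin D -> stanley_reisner K D 'X_[mesym1 A].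
Proof.
move=> AD; rewrite -[X in stanley_reisner K D X]mul1r; apply: ideal_genM.
by exists A => //; rewrite prod_mpolyX.
Qed.

(** Flagness reduces to elements of degree two. Their monomials are divisible by x^A for a nonface
    [A], which has at least two points and so is an edge. *)
Lemma stanley_reisner_edge f m : stanley_reisner K D f -> m \in msupp f ->
  exists2 e, e \in complement_edges D & (mesym1 e <= m)%MM.
Proof.
move=> /hflag[s sI ->] /msupp_sum_mem[x /sI[[r rI ->] hx]].
move=> /msuppM_dvd[m1 [m2 [_ xm2 ->]]]; have dm2 := dhomog_mf hx xm2.
have [y /rI[A AD ->]] := msupp_sum_mem xm2.
rewrite prod_mpolyX => /msuppM_dvd[m3 [m4 [_ + m2E]]].
rewrite msuppX inE => /eqP m4E; exists A.
  rewrite inE AD andbT eqn_leq card_nonface // andbT -mdeg_mesym1 -dm2 /= m2E.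
  by rewrite mdegD m4E leq_addl.
by rewrite m2E m4E; apply: lepm_trans (lem_addl _ _) (lem_addl _ _).
Qed.

(** In dimension one a triple is a nonface, so x^U is in the ideal and an edge divides it. *)
Lemma edge_in_triple U : dimension D = 1%N -> #|U| = 3%N ->
  exists2 e, e \in complement_edges D & e \subset U.
Proof.
move=> hdim cU; have UD : U \notin D.
  apply/negP=> UD; have := @leq_bigmax_cond _ (mem D) (fun A => #|A|) _ UD.
  by rewrite cU; move: hdim; rewrite /dimension /=; lia.
have := stanley_reisner_edge (stanley_reisner_nonface UD) (m := mesym1 U).
by rewrite msuppX inE eqxx => /(_ isT)[e eE]; rewrite mesym1_le; exists e.
Qed.

Lemma sqfree_pow_stanley_reisner q :
  monomial_ideal (sqfree_pow (stanley_reisner K D) q)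
    (matched_sets (complement_edges D) q).
Proof.
apply: sqfree_pow_monomial => [e|e|]; first exact: card_complement_edge.
  by rewrite inE => /andP[_ eD]; exact: stanley_reisner_nonface.
by move=> f Jf m; exact: stanley_reisner_edge.
Qed.

End Flag.
End SquarefreePowers.

Local Close Scope ring_scope.

Theorem corollary4p4 (K : fieldType) (n : nat) (D : {set {set 'I_n}})
    (hD : simplicial_complex D) (hdim : dimension D = 1) (hflag : flag K D)
    (p : nat) (hp2 : 2 <= p) (hpnu : p <= matching_number (complement_edges D)) :
  has_linear_resolution (sqfree_pow (stanley_reisner K D) p) ->
  forall q : nat, p <= q -> q <= matching_number (complement_edges D) ->
    has_linear_resolution (sqfree_pow (stanley_reisner K D) q).
Proof.
have E3 U cU := edge_in_triple hD hflag (U := U) hdim cU.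
have cE := @card_complement_edge n D.
have JM q := sqfree_pow_stanley_reisner hD hflag q.
have cM q V : V \in matched_sets (complement_edges D) q -> #|V| = q.*2.
  by rewrite inE; apply: card_matched.
move=> lin_p q le_pq _; apply: separates_linear (JM q); first exact: cM.
(* What remains is separation for [q]: it holds at [p] by linearity and climbs by
   [cob_separates_wedge]. *)
elim: q le_pq => [|q IH]; first by lia.
rewrite leq_eqVlt => /orP[/eqP <-|lt_pq]; last first.
  by apply: cob_separates_wedge => //; [lia | exact: IH].
apply: linear_separates (JM p) _ _ _ _ lin_p; first exact: cM.
- by rewrite double_gt0; lia.
- have [V mV] := matched_matching_number hpnu.
  by apply/set0Pn; exists V; rewrite inE.
move=> U cU; have [V mV sV] := matched_sub cE E3 cU.
by exists V; rewrite ?inE.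
Qed.
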